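(* Let $X$ and $Y$ be nonzero real Banach spaces. Then $Lip_0^{ph}(X,Y)$ is a closed subspace of $Lip_0(X,Y)$, it contains $L(X,Y)$ as a closed subspace, and both inclusions are strict: $L(X,Y)\subsetneq Lip_0^{ph}(X,Y)\subsetneq Lip_0(X,Y)$. In particular (for $Y=\mathbb{R}$), $X^*\subsetneq Lip_0^{ph}(X)\subsetneq Lip_0(X)$.
   Context: $Lip_0(X,Y)$ is the Banach space of all Lipschitz maps $f:X\to Y$ with $f(0)=0$, with norm $Lip(f)=\sup_{x\neq w}\frac{\|f(x)-f(w)\|}{\|x-w\|}$. $Lip_0^{ph}(X,Y)=\{f\in Lip_0(X,Y): f(\alpha x)=\alpha f(x)\ \forall \alpha\ge 0,\ x\in X\}$ is the space of positively homogeneous Lipschitz maps, with the norm $Lip(\cdot)$. $L(X,Y)$ is the space of bounded linear maps from $X$ to $Y$. For $Y=\mathbb{R}$ write $Lip_0(X)$ and $Lip_0^{ph}(X)$. *)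

(* Defs.v *)
From HB Require Import structures.
From mathcomp Require Import all_boot all_order all_algebra.
From mathcomp Require Import all_classical all_reals all_analysis.

Set Implicit Arguments.
Unset Strict Implicit.
Unset Printing Implicit Defensive.

Import Order.TTheory GRing.Theory Num.Theory.
Import numFieldNormedType.Exports.

Local Open Scope classical_set_scope.
Local Open Scope ring_scope.

Section LipschitzSpaces.
Context {R : realType}.
Implicit Types X Y : normedModType R.

Definition lip0 X Y : set (X -> Y) := [set f | lipschitz f /\ f 0 = 0].

Definition lip0ph X Y : set (X -> Y) :=
  [set f | lip0 f /\
           forall (a : R) (x : X), 0 <= a -> f (a *: x) = a *: f x].

Definition bounded_linear X Y : set (X -> Y) :=
  [set f | linear f /\ bounded_fun_norm f].

Definition dual X : set (X -> R) := @bounded_linear X R.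

(* The Lipschitz constant Lip(f), used below as the norm of Lip_0(X,Y).
   When X is trivial the set is empty, and the supremum is 0 by convention. *)
Definition lip_norm X Y (f : X -> Y) : R :=
  sup [set q | exists x w : X, x != w /\ q = `|f x - f w| / `|x - w|].

Definition op_norm X Y (f : X -> Y) : R :=
  sup [set `|f x| | x in [set x : X | `|x| <= 1]].

End LipschitzSpaces.

Arguments lip0 {R} X Y.
Arguments lip0ph {R} X Y.
Arguments bounded_linear {R} X Y.
Arguments dual {R} X.

Section Lip0Type.
Context (R : realType) (X Y : normedModType R).

Definition lip0_pred : {pred X -> Y} := [pred f | f \in lip0 X Y].

Record Lip0 := MkLip0 { lip0_val :> X -> Y ; _ : lip0_val \in lip0_pred }.

HB.instance Definition _ := [isSub for lip0_val].
HB.instance Definition _ := [Choice of Lip0 by <:].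

Lemma lipschitzE (f : X -> Y) :
  lipschitz f <-> exists k : R, forall x w, `|f x - f w| <= k * `|x - w|.
Proof.
split.
  by move=> /pinfty_ex_gt0[k _ kP]; exists k => x w; exact: (kP (x, w)).
move=> [k kP]; apply: (@klipschitzW _ _ _ k).
  exact: (@globally_properfilter _ _ (0, 0)).
by move=> [x w] _; exact: kP.
Qed.

Lemma lip0_submod_closed : submod_closed lip0_pred.
Proof.
split.
  rewrite !inE; split=> //; apply/lipschitzE; exists 0 => x w.
  by rewrite subrr normr0 mul0r.
move=> a f g; rewrite !inE => -[/lipschitzE[k kP] f0] [/lipschitzE[l lP] g0].
split; last first.
  by rewrite -[LHS]/(a *: f 0 + g 0) f0 g0 scaler0 addr0.
apply/lipschitzE; exists (`|a| * k + l) => x w.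
have -> : (a *: f + g) x - (a *: f + g) w = a *: (f x - f w) + (g x - g w).
  by rewrite scalerBr addrACA -opprD.
rewrite (le_trans (ler_normD _ _))// normrZ mulrDl -mulrA.
by rewrite lerD// ler_wpM2l.
Qed.

HB.instance Definition _ :=
  GRing.isSubmodClosed.Build R (X -> Y) lip0_pred lip0_submod_closed.

HB.instance Definition _ := [SubChoice_isSubLmodule of Lip0 by <:].

Let quot (f : X -> Y) : set R :=
  [set q | exists x w : X, x != w /\ q = `|f x - f w| / `|x - w|].

Lemma lip_norm_ge (f : Lip0) (x w : X) :
  `|f x - f w| <= lip_norm f * `|x - w|.
Proof.
have [->|xw] := eqVneq x w; first by rewrite !subrr !normr0 mulr0.
rewrite -ler_pdivrMr ?normr_gt0 ?subr_eq0//.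
apply: sup_upper_bound; last by exists x, w.
split; first by exists (`|f x - f w| / `|x - w|); exists x, w.
have := valP f; rewrite inE => -[/lipschitzE[k kP] _].
exists k => _ [y [z [yz ->]]].
by rewrite ler_pdivrMr ?normr_gt0 ?subr_eq0//; exact: kP.
Qed.

Lemma lip_norm_le (f : Lip0) (k : R) : 0 <= k ->
  (forall x w, `|f x - f w| <= k * `|x - w|) -> lip_norm f <= k.
Proof.
move=> k0 kP; rewrite /lip_norm -/(quot f).
have [->|/set0P q0] := eqVneq (quot f) set0; first by rewrite sup0.
apply: ge_sup => // _ [y [z [yz ->]]].
by rewrite ler_pdivrMr ?normr_gt0 ?subr_eq0//; exact: kP.
Qed.

Lemma lip_norm_ge0 (f : Lip0) : 0 <= lip_norm f.
Proof.
rewrite /lip_norm -/(quot f).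
have [->|/set0P[_ [x [w [xw _]]]]] := eqVneq (quot f) set0.
  by rewrite sup0.
have xw0 : 0 < `|x - w| by rewrite normr_gt0 subr_eq0.
by rewrite -(pmulr_lge0 _ xw0); exact: le_trans (lip_norm_ge f x w).
Qed.

Lemma lip_normD (f g : Lip0) :
  lip_norm (f + g : Lip0) <= lip_norm f + lip_norm g.
Proof.
apply: lip_norm_le => [|x w]; first by rewrite addr_ge0 ?lip_norm_ge0.
have -> : (f + g : Lip0) x - (f + g : Lip0) w = (f x - f w) + (g x - g w).
  by rewrite addrACA -opprD.
by rewrite (le_trans (ler_normD _ _))// mulrDl lerD ?lip_norm_ge.
Qed.

Lemma lip_normZ (a : R) (f : Lip0) :
  lip_norm (a *: f : Lip0) = `|a| * lip_norm f.
Proof.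
have le b (g : Lip0) : lip_norm (b *: g : Lip0) <= `|b| * lip_norm g.
  apply: lip_norm_le => [|x w]; first exact: mulr_ge0 (lip_norm_ge0 g).
  have -> : (b *: g : Lip0) x - (b *: g : Lip0) w = b *: (g x - g w).
    by rewrite scalerBr.
  by rewrite normrZ -mulrA ler_wpM2l// lip_norm_ge.
apply/eqP; rewrite eq_le; apply/andP; split; first exact: le.
have [->|a0] := eqVneq a 0; first by rewrite normr0 mul0r; exact: lip_norm_ge0.
rewrite -ler_pdivlMl ?normr_gt0// -normfV.
by rewrite -[in leLHS](scalerK a0 f) le.
Qed.

Lemma lip_norm_eq0 (f : Lip0) : lip_norm f = 0 -> f = 0.
Proof.
move=> f0; apply: val_inj; apply/funext => x /=.
have [_ fx0] : lip0 X Y f by have := valP f; rewrite inE.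
have := lip_norm_ge f x 0; rewrite f0 mul0r fx0 subr0 normr_le0.
by move=> /eqP.
Qed.

HB.instance Definition _ :=
  Lmodule_isNormed.Build R Lip0 lip_normD lip_normZ lip_norm_eq0.

End Lip0Type.

(* Main.v *)
From HB Require Import structures.
Require Import Defs.
From mathcomp Require Import all_boot all_order all_algebra.
From mathcomp Require Import all_classical all_reals all_analysis.
From mathcomp Require Import lra.
Import Order.TTheory GRing.Theory Num.Theory.
Import numFieldNormedType.Exports.
Set Implicit Arguments.
Unset Strict Implicit.
Unset Printing Implicit Defensive.
Local Open Scope classical_set_scope.
Local Open Scope ring_scope.

(** Point evaluations are continuous on [Lip0 X Y], so positive homogeneity and
    linearity, being conditions on finitely many values at a time, cut out
    closed subspaces.  For [y != 0], the map [x |-> `|x| y] is positively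
    homogeneous but not odd, and [x |-> min(1, `|x|) y] is Lipschitz but
    bounded. *)

Section LinearMaps.
Context (R : realType) (X Y : normedModType R) (f : X -> Y).
Hypothesis fL : linear f.

Lemma linear_fun0 : f 0 = 0.
Proof.
by have := fL (-1) 0 0; rewrite scaler0 addr0 scaleN1r addNr.
Qed.

Lemma linear_funZ (a : R) x : f (a *: x) = a *: f x.
Proof. by rewrite -[a *: x]addr0 fL linear_fun0 addr0. Qed.

Lemma linear_funB x w : f (x - w) = f x - f w.
Proof. by rewrite -[x - w]addrC -scaleN1r fL scaleN1r addrC. Qed.

(** By homogeneity, rescaling a nonzero [x] to norm 1 reduces the estimate to the unit ball. *)
Lemma linear_norm_le (M : R) :
  (forall x, `|x| <= 1 -> `|f x| <= M) -> forall x, `|f x| <= M * `|x|.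
Proof.
move=> fM x; have [->|x0] := eqVneq x 0.
  by rewrite linear_fun0 !normr0 mulr0.
have nx0 : 0 < `|x| by rewrite normr_gt0.
rewrite -ler_pdivrMr// mulrC.
have := fM (`|x|^-1 *: x).
by rewrite linear_funZ !normrZ normfV normr_id mulVf ?gt_eqF// => /(_ (lexx _)).
Qed.

End LinearMaps.

Section PointEvaluation.
Context (R : realType) (X Y : normedModType R).
Implicit Types (f g : Lip0 X Y) (x : X).

Lemma lip0_valP f : lip0 X Y f.
Proof. by have := valP f; rewrite inE. Qed.

Lemma lip0_at0 f : f 0 = 0.
Proof. by case: (lip0_valP f). Qed.

Lemma norm_lip0_le f x : `|f x| <= `|f| * `|x|.
Proof. by have := lip_norm_ge f x 0; rewrite lip0_at0 !subr0. Qed.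

Lemma continuous_lip0_eval x : continuous (fun f : Lip0 X Y => f x).
Proof.
pose ev : Lip0 X Y -> Y := fun f => f x.
have evL : linear ev by [].
pose evl := GRing.isLinear.Build R (Lip0 X Y) Y *:%R ev evL.
pose E : {linear Lip0 X Y -> Y} := HB.pack ev evl.
apply: (@linear_bounded_continuous _ _ _ E).1.
(* Evaluation at [x] has operator norm at most [|x|], so any [r] above [|x|] works. *)
apply/linear_boundedP; near=> r => f.
rewrite (le_trans (norm_lip0_le f x))// mulrC ler_wpM2r//.
Unshelve. all: by end_near.
Qed.

(** An intersection of preimages of the closed set [[set 0]]. The index type allows one equation per
    tuple of scalars and vectors. *)
Lemma closed_lip0_kernel (I : Type) (P : set I) (F : I -> Lip0 X Y -> Y) :
  (forall i, P i -> continuous (F i)) ->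
  closed [set f | forall i, P i -> F i f = 0].
Proof.
move=> Fc.
rewrite (_ : [set _ | _] = \bigcap_(i in P) (F i @^-1` [set 0])) //.
apply: closed_bigI => i Pi; apply: preimage_closed => [f _|]; first exact: Fc.
exact/accessible_closed_set1/hausdorff_accessible/norm_hausdorff.
Qed.

Lemma closed_lip0ph : closed [set f : Lip0 X Y | lip0ph X Y f].
Proof.
(* Every [f : Lip0 X Y] is already in [lip0], so only the homogeneity equations remain, indexed by
   pairs [(a, x)]. *)
have -> : [set f : Lip0 X Y | lip0ph X Y f] =
    [set f : Lip0 X Y | forall p, 0 <= p.1 ->
      f (p.1 *: p.2) - p.1 *: f p.2 = 0]; last first.
  apply: closed_lip0_kernel => -[a x] _ f /=.
  have ev z := @continuous_lip0_eval z f.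
  exact: (cvgB (ev (a *: x)) (cvgZl_tmp (ev x))).
apply/seteqP; split=> f /=.
  by move=> [_ fP] [a x] /= a0; rewrite fP// subrr.
move=> fP; split; first exact: lip0_valP.
by move=> a x a0; apply/eqP; rewrite -subr_eq0 (fP (a, x)).
Qed.

(** The Lipschitz bound at 0 already controls [f] on every ball, so inside [Lip0 X Y] only the
    algebraic condition has to be checked. *)
Lemma linear_lip0_bounded f : linear f -> bounded_linear X Y f.
Proof.
move=> fL; split=> // r; exists (`|f| * r) => x xr.
by rewrite (le_trans (norm_lip0_le f x))// ler_wpM2l.
Qed.

Lemma closed_lip0_linear : closed [set f : Lip0 X Y | bounded_linear X Y f].
Proof.
have -> : [set f : Lip0 X Y | bounded_linear X Y f] =
    [set f : Lip0 X Y | forall p, True ->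
      f (p.1.1 *: p.1.2 + p.2) - (p.1.1 *: f p.1.2 + f p.2) = 0]; last first.
  apply: closed_lip0_kernel => -[[a x] w] _ f /=.
  have ev z := @continuous_lip0_eval z f.
  exact: (cvgB (ev (a *: x + w)) (cvgD (cvgZl_tmp (ev x)) (ev w))).
apply/seteqP; split=> f /=.
  by move=> [fL _] [[a x] w] _ /=; rewrite fL subrr.
move=> fP; apply: linear_lip0_bounded => a x w.
by apply/eqP; rewrite -subr_eq0 (fP (a, x, w)).
Qed.

Lemma submod_closed_lip0ph :
  submod_closed (mem [set f : Lip0 X Y | lip0ph X Y f] : {pred Lip0 X Y}).
Proof.
split=> [|a f g]; rewrite !inE /=.
  by split=> [|b x _]; [exact: (lip0_valP 0)|rewrite /= scaler0].
move=> [_ fP] [_ gP]; split=> [|b x b0]; first exact: (lip0_valP (a *: f + g)).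
rewrite -[LHS]/(a *: f (b *: x) + g (b *: x)) fP// gP//.
by rewrite -[in RHS]/(a *: f x + g x) scalerDr !scalerA mulrC.
Qed.

Lemma submod_closed_lip0_linear :
  submod_closed (mem [set f : Lip0 X Y | bounded_linear X Y f] :
                  {pred Lip0 X Y}).
Proof.
split=> [|a f g]; rewrite !inE /=.
  apply: (@linear_lip0_bounded 0) => b x w.
  by rewrite /= scaler0 addr0.
move=> [fL _] [gL _]; apply: (@linear_lip0_bounded (a *: f + g)) => b x w.
rewrite -[LHS]/(a *: f (b *: x + w) + g (b *: x + w)) fL gL.
rewrite -[RHS]/(b *: (a *: f x + g x) + (a *: f w + g w)).
by rewrite !scalerDr !scalerA addrACA (mulrC a b).
Qed.

(** For linear [f] the difference quotient at [x], [w] depends only on [x - w]. Hence [L] carries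
    its usual norm as a subspace. *)
Lemma lip_norm_linear f : linear f -> `|f| = op_norm f.
Proof.
move=> fL; pose S := [set `|f x| | x in [set x : X | `|x| <= 1]].
have ubS : ubound S `|f|.
  move=> _ [x x1 <-]; rewrite (le_trans (norm_lip0_le f x))//.
  by rewrite -[leRHS]mulr1 ler_wpM2l.
(* This makes [S] nonempty and also gives [0 <= sup S], as [lip_norm_le] requires. *)
have S0 : S 0 by exists 0; rewrite /= ?lip0_at0 ?normr0.
have supS : has_sup S by split; [exists 0|exists `|f|].
apply/eqP; rewrite eq_le; apply/andP; split; last first.
  by apply: ge_sup => //; exists 0.
apply: lip_norm_le => [|x w]; first exact: sup_upper_bound.
rewrite -linear_funB//; apply: linear_norm_le => // z z1.
by apply: sup_upper_bound => //; exists z.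
Qed.

End PointEvaluation.

Section StrictInclusions.
Context (R : realType) (X Y : normedModType R).

Lemma bounded_linear_lip0ph : bounded_linear X Y `<=` lip0ph X Y.
Proof.
move=> f [fL fb]; split=> [|a x _]; last exact: linear_funZ.
split; last exact: linear_fun0.
(* A bound on the unit ball serves as a Lipschitz constant. *)
have [M MP] := fb 1; apply/lipschitzE; exists M => x w.
by rewrite -linear_funB//; exact: linear_norm_le.
Qed.

Hypotheses (hX : exists x : X, x != 0) (hY : exists y : Y, y != 0).

Lemma bounded_linear_proper_lip0ph : bounded_linear X Y `<` lip0ph X Y.
Proof.
split; first exact: bounded_linear_lip0ph.
have [x0 x00] := hX; have [y0 y00] := hY.
move=> /(_ (fun x => `|x| *: y0))[].
  split=> [|a x a0]; last by rewrite normrZ ger0_norm// scalerA.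
  split; last by rewrite normr0 scale0r.
  apply/lipschitzE; exists `|y0| => x w.
  by rewrite -scalerBl normrZ mulrC ler_wpM2l// ler_dist_dist.
(* Linearity would force [|x0| *: y0] to equal its own opposite, although both factors are
   nonzero. *)
move=> fL _; have := linear_funZ fL (-1) x0.
rewrite scaleN1r normrN scaleN1r => /eqP.
by rewrite -addr_eq0 -scalerDl scaler_eq0 (negbTE y00) orbF -mulr2n mulrn_eq0
  normr_eq0 (negbTE x00).
Qed.

Lemma lip0ph_proper_lip0 : lip0ph X Y `<` lip0 X Y.
Proof.
split; first by move=> f [].
have [x0 x00] := hX; have [y0 y00] := hY.
move=> /(_ (fun x => Num.min 1 `|x| *: y0))[].
  split; last by rewrite normr0 min_r// scale0r.
  apply/lipschitzE; exists `|y0| => x w.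
  (* It remains to see that truncation at 1 is 1-Lipschitz on the reals, by comparing [a] and [b]
     with each other and with 1. *)
  rewrite -scalerBl normrZ mulrC ler_wpM2l// (le_trans _ (ler_dist_dist _ _))//.
  move: `|x| `|w| => a b; rewrite ler_norml !minElt.
  by case: (ger0P (a - b)); case: (ltP 1 a); case: (ltP 1 b) => *;
    apply/andP; split; lra.
have nx0 : `|x0| != 0 by rewrite normr_eq0.
(* At a unit vector the map takes the value [y0]; doubling the vector leaves the value at [y0],
   while homogeneity demands [2 *: y0]. *)
move=> _ /(_ 2 (`|x0|^-1 *: x0)).
rewrite !normrZ normfV normr_id mulVf// mulr1 ger0_norm//.
rewrite minxx min_l ?ler1n// scale1r => /(_ (ler0n _ _))/eqP.
by rewrite scaler_nat mulr2n -[eqbLHS]addr0 (inj_eq (addrI y0)) eq_sym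
  (negbTE y00).
Qed.

End StrictInclusions.

Theorem mainTheorem2 (R : realType) (X Y : completeNormedModType R)
    (hX : exists x : X, x != 0) (hY : exists y : Y, y != 0) :
  let PH := [set f : Lip0 X Y | lip0ph X Y f] in
  let L := [set f : Lip0 X Y | bounded_linear X Y f] in
  [/\ submod_closed (mem PH : {pred Lip0 X Y}) /\ closed PH,
      [/\ L `<=` PH,
          submod_closed (mem L : {pred Lip0 X Y}),
          closed (L : set (subspace PH))
        & forall f : Lip0 X Y, L f -> `|f| = op_norm f],
      bounded_linear X Y `<` lip0ph X Y /\ lip0ph X Y `<` lip0 X Y
    & dual X `<` lip0ph X R /\ lip0ph X R `<` lip0 X R].
Proof.
move=> PH L.
have one0 : exists y : R, y != 0 by exists 1; exact: oner_neq0.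
split.
- by split; [exact: submod_closed_lip0ph|exact: closed_lip0ph].
- split.
  + by move=> f fL; exact: bounded_linear_lip0ph fL.
  + exact: submod_closed_lip0_linear.
  (* Closedness in all of [Lip0 X Y] implies closedness relative to [PH]. *)
  + by apply: closed_subspaceW; exact: closed_lip0_linear.
  + by move=> f [fL _]; exact: lip_norm_linear.
- by split; [exact: bounded_linear_proper_lip0ph|exact: lip0ph_proper_lip0].
- by split; [exact: bounded_linear_proper_lip0ph|exact: lip0ph_proper_lip0].
Qed.
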